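(* Let $\varepsilon>0$ and $\mu=\frac{\varepsilon C(\mathbf{x}_{\mathrm{greedy}})}{2\log d_R}$, and let $\mathbf{x}^{(t)}$ be the accelerated projected gradient iterates with step size $\eta=\frac{4\mu}{d_R}$. If $t\ge\frac{5.1}{\varepsilon}\,n\sqrt{\log n}$, then \[ \widetilde{C}_\mu(\mathbf{x}^{(t)})\ \ge\ (1-\varepsilon)\cdot C(\mathbf{x}^* ). \]
   Context: Setting: bipartite graph $G=(L,R,E)$ with $L=[n]$, every $j\in R$ of degree $\deg(j)=|N(j)|\ge1$, weights $w_j\ge0$ with $\sum_jw_j=1$, integer $1\le k\le n$, $\varphi:\mathbb{Z}_{\ge0}\to\mathbb{R}$ concave nondecreasing with $\varphi(0)=0$, $\varphi(1)=1$, extended piecewise linearly to $\mathbb{R}_{\ge0}$. $d_R=\sum_jw_j\deg(j)$ (assumed $>1$), $C(\mathbf{x})=\sum_jw_j\varphi(\sum_{i\in N(j)}x_i)$, $\Delta_{n,k}=\{\mathbf{x}\in[0,1]^n:\sum_ix_i=k\}$, $\mathbf{x}^*\in\arg\max_{\Delta_{n,k}}C$. $\mathbf{x}_{\mathrm{greedy}}=\mathbf{1}_{S_k}$ where $S_0=\emptyset$ and $S_{t+1}=S_t\cup\{i\}$ for $i\in L\setminus S_t$ maximizing $C(S_t\cup\{i\})-C(S_t)$, with $C(S)=\sum_jw_j\varphi(|S\cap N(j)|)$. Smoothed objective: $\widetilde{C}_\mu(\mathbf{x})=\sum_jw_j\big(-\mu\log\sum_{i=1}^{\deg(j)}e^{-\ell_{j,i}(\mathbf{x})/\mu}\big)$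 with $\ell_{j,i}(\mathbf{x})=\varphi(i-1)+(\varphi(i)-\varphi(i-1))(\sum_{u\in N(j)}x_u-(i-1))$. Iterates: $\mathbf{x}^{(0)}=\mathbf{y}^{(0)}=\mathbf{x}_{\mathrm{greedy}}$, $\beta_0=1$, $\mathbf{x}^{(t+1)}=\Pi_{\Delta_{n,k}}(\mathbf{y}^{(t)}+\eta\nabla\widetilde{C}_\mu(\mathbf{y}^{(t)}))$, $\beta_{t+1}=(1+\sqrt{1+4\beta_t^2})/2$, $\mathbf{y}^{(t+1)}=\mathbf{x}^{(t+1)}+\frac{\beta_t-1}{\beta_{t+1}}(\mathbf{x}^{(t+1)}-\mathbf{x}^{(t)})$, with $\Pi_{\Delta_{n,k}}$ Euclidean projection. *)

(* Defs.v *)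
From HB Require Import structures.
From mathcomp Require Import all_boot all_order all_algebra.
From mathcomp Require Import all_classical all_reals all_analysis.
Set Implicit Arguments. Unset Strict Implicit. Unset Printing Implicit Defensive.
Import Order.TTheory GRing.Theory Num.Theory.
Import numFieldNormedType.Exports.
Local Open Scope ring_scope.

Section Defs.
Variable R : realType.

Definition admissible_phi (phi : nat -> R) : Prop :=
  [/\ phi 0%N = 0, phi 1%N = 1,
      (forall i : nat, phi i <= phi i.+1) &
      (forall i : nat, phi i.+2 - phi i.+1 <= phi i.+1 - phi i)].

Definition phi_ext (phi : nat -> R) (s : R) : R :=
  let f := Num.truncn s in
  phi f + (phi f.+1 - phi f) * (s - f%:R).

Variables (n : nat) (RT : finType) (N : RT -> {set 'I_n}) (w : RT -> R)
          (phi : nat -> R).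

Definition deg (j : RT) : nat := #|N j|.

Definition dR : R := \sum_j w j * (deg j)%:R.

Definition load (x : 'rV[R]_n) (j : RT) : R := \sum_(u in N j) x 0 u.

Definition Cobj (x : 'rV[R]_n) : R := \sum_j w j * phi_ext phi (load x j).

Definition Cset (S : {set 'I_n}) : R := \sum_j w j * phi #|S :&: N j|.

Definition in_Delta (k : nat) (x : 'rV[R]_n) : Prop :=
  (forall i, 0 <= x 0 i <= 1) /\ \sum_i x 0 i = k%:R.

Definition indicvec (S : {set 'I_n}) : 'rV[R]_n := \row_i (i \in S)%:R.

Definition greedy_seq (k : nat) (S : nat -> {set 'I_n}) : Prop :=
  S 0%N = finset.set0 /\
  forall t, (t < k)%N ->
    exists i, [/\ i \notin S t, S t.+1 = i |: S t &
      forall i', i' \notin S t ->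
        Cset (i' |: S t) - Cset (S t) <= Cset (i |: S t) - Cset (S t)].

Definition ell (x : 'rV[R]_n) (j : RT) (i : nat) : R :=
  phi i.-1 + (phi i - phi i.-1) * (load x j - (i.-1)%:R).

Definition Ctilde (mu : R) (x : 'rV[R]_n) : R :=
  \sum_j w j * (- mu * ln (\sum_(1 <= i < (deg j).+1) expR (- ell x j i / mu))).

Definition grad (f : 'rV[R]_n -> R) (y : 'rV[R]_n) : 'rV[R]_n :=
  \row_u ('D_(delta_mx 0 u) f y).

Definition sqdist (v p : 'rV[R]_n) : R := \sum_i (v 0 i - p 0 i) ^+ 2.

Definition is_proj_Delta (k : nat) (v p : 'rV[R]_n) : Prop :=
  in_Delta k p /\ forall z, in_Delta k z -> sqdist v p <= sqdist v z.

End Defs.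

Fixpoint beta (R : realType) (t : nat) : R :=
  match t with
  | 0%N => 1
  | t'.+1 => (1 + Num.sqrt (1 + 4 * beta R t' ^+ 2)) / 2
  end.

(* Main.v *)
Require Import Defs.
From HB Require Import structures.
From mathcomp Require Import all_boot all_order all_algebra.
From mathcomp Require Import all_classical all_reals all_analysis.
From mathcomp Require Import ring lra.
Import Order.TTheory GRing.Theory Num.Theory.
Import numFieldNormedType.Exports.
Local Open Scope ring_scope.

(* Each term of the smoothed objective is a soft minimum of affine functions of
   the load with slopes in [0, 1]. Tilting the soft minimum and Jensen's
   inequality give concavity, and Hoeffding's lemma gives curvature at most
   1/(4 mu); with Cauchy-Schwarz on the loads, Ctilde is dR/(4 mu)-smooth, so
   eta is the inverse smoothness constant and the accelerated gradient rate
   2 L |xg - xstar|^2 / t^2 applies, with |xg - xstar|^2 <= 2 k.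
   The smoothing costs at most mu ln dR = eps C(xg) / 2, because the average of
   ln deg is at most ln dR. The optimization error is at most eps C(xstar) / 2
   because C(xg) >= dR / n, already after the first greedy pick, and
   C(xstar) >= k / n, as witnessed by the uniform point. *)

(** * Hoeffding's lemma for variables in [0, 1] *)

Lemma ge0_of_derive_ge0 (R : realType) (f df : R -> R) :
  (forall x : R, is_derive x 1 f (df x)) -> f 0 = 0 ->
  (forall x, 0 <= x -> 0 <= df x) -> forall x, 0 <= x -> 0 <= f x.
Proof.
move=> fd f0 df0 x x0; rewrite -f0.
apply: (@ger0_derive1_ndecry _ f 0) => //.
- by move=> z; rewrite in_itv/= andbT => z0; rewrite derive1E derive_val df0// ltW.
- apply: derivable_within_continuous => z _; exact: (@ex_derive _ _ _ _ _ _ _ (fd z)).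
Qed.

Lemma bernoulli_mgf_gt0 (R : realType) (p h : R) :
  0 <= p <= 1 -> 0 < 1 - p + p * expR h.
Proof.
move=> /andP[p0 p1]; have e0 := expR_gt0 h.
have [->|pn1] := eqVneq p 1; first by rewrite subrr add0r mul1r.
by rewrite ltr_wpDr ?mulr_ge0 ?expR_ge0// subr_gt0 lt_neqAle pn1.
Qed.

(* The second derivative of h |-> ln (1 - p + p e^h) is q (1 - q) <= 1/4, with
   q the tilted success probability; hence two integrations from h = 0. *)
Lemma bernoulli_mgf_le_pos (R : realType) (p h : R) : 0 <= p <= 1 -> 0 <= h ->
  1 - p + p * expR h <= expR (p * h + h ^+ 2 / 8).
Proof.
move=> p01; have D0 z := bernoulli_mgf_gt0 _ p z p01.
have Dn0 z : 1 - p + p * expR z != 0 by rewrite gt_eqF.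
(* [L] is the logarithm of the right side over the left side and [Q] is its derivative. Both vanish
   at 0, and [Q] has derivative (q - 1/2)^2. *)
pose q (z : R) := p * expR z / (1 - p + p * expR z).
pose Q (z : R) := z / 4 + p - q z.
pose L (z : R) := p * z + z ^+ 2 / 8 - ln (1 - p + p * expR z).
pose D (z : R) := 1 - p + p * expR z.
have dD (z : R) : is_derive z 1 D (p * expR z).
  by apply: is_derive_eq; rewrite /GRing.scale/=; ring.
have dV (z : R) := @is_deriveV R D z _ 1 (Dn0 z) (dD z).
have dln (z : R) := @is_derive1_comp R _ D z _ _ (is_derive1_ln (D0 z)) (dD z).
pose E (z : R) := p * expR z.
have dE (z : R) : is_derive z 1 E (p * expR z) := is_deriveZ p (is_derive_expR z).
have dQ (z : R) : is_derive z 1 Q (4^-1 - q z * (1 - q z)).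
  have -> : Q = 4^-1 \*: id + cst p - E * (fun z => (D z)^-1).
    by apply/funext => u; rewrite /Q /q (mulrC u).
  apply: is_derive_eq; rewrite /q /E /D /GRing.scale/=; field; exact: Dn0.
have dL (z : R) : is_derive z 1 L (Q z).
  have -> : L = p \*: id + 8^-1 \*: (id ^+ 2) - (@ln R \o D).
    by apply/funext => u; rewrite /L (mulrC (u ^+ 2)).
  apply: is_derive_eq; rewrite /Q /q /D /GRing.scale/=; field; exact: Dn0.
have Q0 : forall z, 0 <= z -> 0 <= Q z.
  apply: (ge0_of_derive_ge0 _ _ _ dQ).
    by rewrite /Q /q expR0 mulr1 subrK divr1 mul0r add0r subrr.
  by move=> z _; rewrite (_ : _ - _ = (q z - 2^-1) ^+ 2) ?sqr_ge0//; field.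
have L0 : L 0 = 0 by rewrite /L expR0 mulr1 subrK ln1; ring.
move=> h0; have := ge0_of_derive_ge0 _ _ _ dL L0 Q0 h h0.
by rewrite /L subr_ge0 -ler_expR lnK// posrE.
Qed.

(** For negative h, exchange the two outcomes: passing from (p, h) to (1 - p, -h) divides the
    generating function by e^h. *)
Lemma bernoulli_mgf_le (R : realType) (p h : R) : 0 <= p <= 1 ->
  1 - p + p * expR h <= expR (p * h + h ^+ 2 / 8).
Proof.
move=> p01; have [h0|h0] := leP 0 h; first exact: bernoulli_mgf_le_pos.
have q01 : 0 <= 1 - p <= 1 by lra.
have Nh0 : 0 <= - h by lra.
have := bernoulli_mgf_le_pos _ _ _ q01 Nh0.
rewrite -(ler_pM2l (expR_gt0 h)) -expRD expRN.
have eh : expR h != 0 by rewrite gt_eqF ?expR_gt0.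
rewrite (_ : expR h * _ = 1 - p + p * expR h); last by field.
by rewrite (_ : h + _ = p * h + h ^+ 2 / 8)//; field.
Qed.

(** Convexity of exp from 1 + u <= e^u: the tangent at l a is compared with exp at 0 and at l, and
    the two bounds are averaged with weights 1 - a and a. *)
Lemma expR_chord (R : realType) (a l : R) : 0 <= a <= 1 ->
  expR (l * a) <= 1 - a + a * expR l.
Proof.
move=> /andP[a0 a1]; set E := expR (l * a).
have E0 : 0 <= E := expR_ge0 _.
have h1 : E * (1 - l * a) <= 1.
  by rewrite -[leRHS](expRxMexpNx_1 (l * a)) ler_wpM2l// expR_ge1Dx.
have h2 : E * (1 + (l - l * a)) <= expR l.
  rewrite (_ : expR l = E * expR (l - l * a)) ?ler_wpM2l ?expR_ge1Dx//.
  by rewrite -expRD addrC subrK.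
have a1' : 0 <= 1 - a by lra.
have := lerD (ler_wpM2l a1' h1) (ler_wpM2l a0 h2).
by rewrite mulr1; apply: le_trans; rewrite le_eqVlt; apply/orP; left; apply/eqP; ring.
Qed.

Section Hoeffding.
Variables (R : realType) (I : Type) (r : seq I) (p a : I -> R).
Hypotheses (p0 : forall i, 0 <= p i) (p1 : \sum_(i <- r) p i = 1).

Let m := \sum_(i <- r) p i * a i.

Lemma mean_itv01 : (forall i, 0 <= a i <= 1) -> 0 <= m <= 1.
Proof.
move=> a01; rewrite /m; apply/andP; split.
  by apply: sumr_ge0 => i _; rewrite mulr_ge0//; case/andP: (a01 i).
by rewrite -p1; apply: ler_sum => i _; rewrite ler_piMr//; case/andP: (a01 i).
Qed.

(** The chord bound replaces each value by a Bernoulli variable of the same mean, which leaves the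
    two-point case with parameter [m]. *)
Lemma hoeffding_mgf (l : R) : (forall i, 0 <= a i <= 1) ->
  \sum_(i <- r) p i * expR (l * a i) <= expR (l * m + l ^+ 2 / 8).
Proof.
move=> a01; apply: (@le_trans _ _ (1 - m + m * expR l)).
  rewrite {1}/m mulr_suml -p1 /m -sumrB -big_split/=; apply: ler_sum => i _.
  rewrite (_ : _ + _ = p i * (1 - a i + a i * expR l)); last by ring.
  by rewrite ler_wpM2l// expR_chord.
by rewrite (mulrC l m); apply: bernoulli_mgf_le; exact: mean_itv01.
Qed.

(** Jensen's inequality: the tangent to exp at l m lies below exp, and its linear term averages to
    zero. *)
Lemma expR_mean_le (l : R) :
  expR (l * m) <= \sum_(i <- r) p i * expR (l * a i).
Proof.
have -> : expR (l * m) =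
    \sum_(i <- r) p i * (expR (l * m) * (1 + (l * a i - l * m))).
  transitivity (expR (l * m) * (\sum_(i <- r) p i +
      (l * \sum_(i <- r) p i * a i - l * m * \sum_(i <- r) p i))).
    by rewrite p1 -/m; ring.
  rewrite !mulr_sumr -sumrB -big_split mulr_sumr/=.
  by apply: eq_bigr => i _; ring.
apply: ler_sum => i _; rewrite ler_wpM2l//.
rewrite (_ : expR (l * a i) = expR (l * m) * expR (l * a i - l * m)).
  by rewrite ler_wpM2l ?expR_ge0 ?expR_ge1Dx.
by rewrite -expRD addrC subrK.
Qed.

End Hoeffding.

(** * Soft minimum of affine functions of one real variable *)

Definition softmin (R : realType) (I : Type) (mu : R) (r : seq I)
    (c a : I -> R) (s : R) : R :=
  - mu * ln (\sum_(i <- r) expR (- (c i + a i * s) / mu)).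

Section Softmin.
Variables (R : realType) (I : Type) (mu : R) (r : seq I) (c a : I -> R).
Hypotheses (mu0 : 0 < mu) (r0 : (0 < size r)%N) (a01 : forall i, 0 <= a i <= 1).

Lemma sum_expR_gt0 (e : I -> R) : 0 < \sum_(i <- r) expR (e i).
Proof.
case: r r0 => // i s _; rewrite big_cons ltr_pwDl ?expR_gt0//.
by apply: sumr_ge0 => k _; exact: expR_ge0.
Qed.

(** The slope g is the mean of the [a i] under the Gibbs weights at s. The increment from s to s + d
    is -mu times the log of the generating function of the slopes at -d/mu: Jensen bounds it above,
    Hoeffding below, with no second derivative. *)
Lemma softmin_sandwich (s : R) : exists g : R, forall d : R,
  softmin R I mu r c a s + g * d - d ^+ 2 / (8 * mu) <= softmin R I mu r c a (s + d)
    <= softmin R I mu r c a s + g * d.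
Proof.
have mun0 : mu != 0 by rewrite gt_eqF.
set Z := \sum_(i <- r) expR (- (c i + a i * s) / mu).
have Z0 : 0 < Z := sum_expR_gt0 _.
pose p i := expR (- (c i + a i * s) / mu) / Z.
have p0 i : 0 <= p i by rewrite divr_ge0 ?expR_ge0 ?ltW.
have p1 : \sum_(i <- r) p i = 1 by rewrite -mulr_suml mulfV// gt_eqF.
exists (\sum_(i <- r) p i * a i) => d; set g := \sum_(i <- r) _.
(* Moving s by d only reweights the exponentials, so the partition function factors as [Z] times a
   generating function. *)
have tilt : \sum_(i <- r) expR (- (c i + a i * (s + d)) / mu) =
    Z * \sum_(i <- r) p i * expR ((- d / mu) * a i).
  rewrite mulr_sumr; apply: eq_bigr => i _.
  rewrite /p mulrA (mulrC Z) divfK ?gt_eqF// -expRD; congr expR; field.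
  exact: mun0.
have M0 : 0 < \sum_(i <- r) p i * expR ((- d / mu) * a i).
  by apply: lt_le_trans (expR_mean_le _ _ _ _ _ p0 p1 _); exact: expR_gt0.
have lo := hoeffding_mgf _ _ _ _ _ p0 p1 (- d / mu) a01.
have hi := expR_mean_le _ _ _ _ a p0 p1 (- d / mu).
rewrite -/g in lo hi.
rewrite /softmin tilt lnM ?posrE// mulrDr -/Z.
rewrite -ler_ln ?posrE ?expR_gt0// expRK in lo.
rewrite -ler_ln ?posrE ?expR_gt0// expRK in hi.
set l := ln (\sum_(i <- r) _) in lo hi *.
have := ler_wpM2l (ltW mu0) lo; have := ler_wpM2l (ltW mu0) hi.
rewrite (_ : mu * (_ + _) = - (g * d) + d ^+ 2 / (8 * mu)); last first.
  by field; exact: mun0.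
rewrite (_ : mu * (_ * g) = - (g * d)); last by field; exact: mun0.
by move=> h1 h2; apply/andP; split; lra.
Qed.

(** Each of the [size r] exponentials is at most e^(-b/mu). *)
Lemma softmin_ge (b s : R) : (forall i, b <= c i + a i * s) ->
  b - mu * ln (size r)%:R <= softmin R I mu r c a s.
Proof.
move=> hb; rewrite /softmin.
have Z0 := sum_expR_gt0 (fun i => - (c i + a i * s) / mu).
have : \sum_(i <- r) expR (- (c i + a i * s) / mu) <= (size r)%:R * expR (- b / mu).
  rewrite mulr_natl -iter_addr_0 -(count_predT r) -big_const_seq; apply: ler_sum => i _.
  by rewrite ler_expR ler_pM2r ?invr_gt0// lerN2.
have r0' : 0 < (size r)%:R :> R by rewrite ltr0n.
rewrite -ler_ln ?posrE ?mulr_gt0 ?expR_gt0// lnM ?posrE ?expR_gt0// expRK.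
move/(ler_wpM2l (ltW mu0)); rewrite mulrDr (_ : mu * (- b / mu) = - b); first by lra.
by field; rewrite gt_eqF.
Qed.

End Softmin.

(** * Derivatives from quadratic remainders, Cauchy-Schwarz, and the momentum weights *)

Lemma derive_of_quadratic_remainder (R : realType) (V : normedModType R)
    (f : V -> R) (y v : V) (g K : R) :
  (forall h : R, `|f (y + h *: v) - f y - h * g| <= K * h ^+ 2) -> 'D_v f y = g.
Proof.
move=> fK; rewrite /derive; apply: cvg_lim => //; apply/cvgrPdist_le => e e0.
near=> h.
have h0 : h != 0 by near: h; exact: nbhs_dnbhs_neq.
(* The added 1 keeps the denominator positive when K is 0. *)
have he : `|h| < e / (`|K| + 1).
  by near: h; apply: dnbhs0_lt; rewrite divr_gt0// ltr_wpDl.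
have hp : 0 < `|h| by rewrite normr_gt0.
rewrite /= distrC -(ler_pM2l hp) -normrM /GRing.scale/= mulrBr mulVKf//.
rewrite (addrC _ y); apply: (le_trans (fK h)).
rewrite -real_normK ?num_real// expr2 mulrCA ler_pM2l//.
rewrite ltr_pdivlMr ?ltr_wpDl// in he.
apply: le_trans (ltW he); rewrite mulrC ler_pM2l//.
by rewrite (le_trans (ler_norm K))// lerDl.
Unshelve. all: by end_near.
Qed.

Lemma sqr_sum_le_card (R : realFieldType) (I : finType) (A : {set I}) (v : I -> R) :
  (\sum_(i in A) v i) ^+ 2 <= #|A|%:R * \sum_(i in A) v i ^+ 2.
Proof.
have [A0|A0] := posnP #|A|.
  by rewrite (cards0_eq A0) !big_set0 expr0n mulr0.
set S := \sum_(i in A) v i; set Q := \sum_(i in A) _; set m : R := #|A|%:R.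
have : 0 <= \sum_(i in A) (m * v i - S) ^+ 2 by apply: sumr_ge0 => i _; exact: sqr_ge0.
have -> : \sum_(i in A) (m * v i - S) ^+ 2 = m * (m * Q - S ^+ 2).
  transitivity (\sum_(i in A) (m ^+ 2 * v i ^+ 2 - (2 * m * S) * v i + S ^+ 2)).
    by apply: eq_bigr => i _; ring.
  rewrite big_split sumrB/= -!mulr_sumr sumr_const -/S -/Q -[_ *+ #|A|]mulr_natl -/m.
  ring.
by rewrite pmulr_rge0 ?subr_ge0// ltr0n.
Qed.

(** Since sqrt(1 + 4 b^2) >= 2 b, each step adds at least 1/2, starting from 1. *)
Lemma beta_ge (R : realType) (t : nat) : t.+2%:R / 2 <= beta R t.
Proof.
elim: t => [|t IH]; first by rewrite divff.
rewrite /= ler_pM2r ?invr_gt0// -(natr1 t.+2) addrC lerD2l.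
have b0 : 0 <= 2 * beta R t by rewrite mulr_ge0// (le_trans _ IH)// divr_ge0.
rewrite (@le_trans _ _ (2 * beta R t))//; first by rewrite mulrC -ler_pdivrMr.
by rewrite -[leLHS](ger0_norm b0) -sqrtr_sqr ler_wsqrtr// exprMn -natrX lerDr.
Qed.

(** The recursion picks a root of z^2 - z = beta_t^2; this identity makes the potential
    telescope. *)
Lemma betaS_sqr (R : realType) (t : nat) :
  beta R t.+1 ^+ 2 - beta R t.+1 = beta R t ^+ 2.
Proof.
rewrite /=; set b := beta R t; set q := Num.sqrt _.
have hq : q ^+ 2 = 1 + 4 * b ^+ 2 by rewrite sqr_sqrtr// addr_ge0// mulr_ge0// sqr_ge0.
rewrite (_ : _ - _ = (q ^+ 2 - 1) / 4); last by field.
by rewrite hq; field.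
Qed.

Lemma beta_ge1 (R : realType) (t : nat) : 1 <= beta R t.
Proof.
by apply: le_trans (beta_ge R t); rewrite ler_pdivlMr// mul1r ler_nat.
Qed.

(** * Variational inequality for the Euclidean projection *)

Section Projection.
Variables (R : realType) (n k : nat).

Lemma in_Delta_segment (p z : 'rV[R]_n) (s : R) : 0 <= s <= 1 ->
  in_Delta k p -> in_Delta k z -> in_Delta k (p + s *: (z - p)).
Proof.
move=> /andP[s0 s1] [p01 pk] [z01 zk]; split.
  move=> i; rewrite !mxE; case/andP: (p01 i) => a0 a1; case/andP: (z01 i) => b0 b1.
  by apply/andP; split; nra.
under eq_bigr do rewrite !mxE.
by rewrite big_split/= -mulr_sumr sumrB pk zk subrr mulr0 addr0.
Qed.

Lemma proj_variational (v p z : 'rV[R]_n) :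
  is_proj_Delta k v p -> in_Delta k z ->
  \sum_i (v 0 i - p 0 i) * (z 0 i - p 0 i) <= 0.
Proof.
move=> [pD pmin] zD; rewrite leNgt; apply/negP => B0.
set B := \sum_i _ in B0.
pose Q := sqdist z p.
have key s : 0 <= s <= 1 -> 2 * s * B <= s ^+ 2 * Q.
  move=> s01; have := pmin _ (in_Delta_segment _ _ _ s01 pD zD).
  rewrite (_ : sqdist v (p + _) = sqdist v p - 2 * s * B + s ^+ 2 * Q); first by lra.
  rewrite /sqdist /Q /B !mulr_sumr -sumrB -big_split/=; apply: eq_bigr => i _.
  by rewrite !mxE; ring.
(* The endpoint s = 1 shows that Q is positive and that B / Q is an admissible step. *)
have Q2 : 2 * B <= Q by have := key 1; rewrite mulr1 expr1n mul1r; apply; rewrite ler01 lexx.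
have Q0 : 0 < Q by lra.
(* s = B / Q minimizes s^2 Q - 2 s B, with the negative value -B^2 / Q. *)
have /key : 0 <= B / Q <= 1.
  by apply/andP; split; [rewrite divr_ge0 ?ltW|rewrite ler_pdivrMr// mul1r; lra].
rewrite (_ : 2 * _ * B = 2 * (B ^+ 2 / Q)); last by ring.
rewrite (_ : _ * Q = B ^+ 2 / Q); last by field; rewrite gt_eqF.
have : 0 < B ^+ 2 / Q by rewrite divr_gt0 ?exprn_gt0.
lra.
Qed.

End Projection.

(** * Accelerated projected gradient ascent for a concave L-smooth function *)

Section AcceleratedGradient.
Variables (R : realType) (n k : nat) (f : 'rV[R]_n -> R) (g : 'rV[R]_n -> 'rV[R]_n).
Variable L : R.
Hypothesis L0 : 0 < L.
Hypothesis f_le : forall y z : 'rV[R]_n,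
  f z <= f y + \sum_i g y 0 i * (z 0 i - y 0 i).
Hypothesis f_ge : forall y z : 'rV[R]_n,
  f y + \sum_i g y 0 i * (z 0 i - y 0 i) - L / 2 * sqdist z y <= f z.

(** Concavity compares z with y, smoothness compares p with y, and the variational inequality of the
    projection controls the difference of the linear terms. *)
Lemma gradient_step (y p z : 'rV[R]_n) :
  is_proj_Delta k (y + L^-1 *: g y) p -> in_Delta k z ->
  f z - f p <= L / 2 * (sqdist z y - sqdist z p).
Proof.
move=> hp hz; have := proj_variational _ _ _ _ _ _ hp hz.
rewrite -(pmulr_rle0 _ L0); have := f_le y z; have := f_ge y p.
set A := \sum_i _; set B := \sum_i _; set C := \sum_i _ => h1 h2 h3.
suff : L * C = B - A + L / 2 * sqdist p y - L / 2 * (sqdist z y - sqdist z p) by lra.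
rewrite /A /B /C /sqdist !(mulrBr, mulr_sumr) -!sumrB -big_split -sumrB/=.
apply: eq_bigr => i _; rewrite !mxE; field.
by rewrite gt_eqF.
Qed.

Variables x y : nat -> 'rV[R]_n.
Variable xs : 'rV[R]_n.
Hypothesis xsD : in_Delta k xs.
Hypothesis x0D : in_Delta k (x 0%N).
Hypothesis y0 : y 0%N = x 0%N.
Hypothesis x_step : forall t, is_proj_Delta k (y t + L^-1 *: g (y t)) (x t.+1).
Hypothesis y_step : forall t,
  y t.+1 = x t.+1 + ((beta R t - 1) / beta R t.+1) *: (x t.+1 - x t).

(* beta (beta - 1) times the step inequality at x_t plus beta times the one at xs. *)
Lemma potential_step (t : nat) :
  beta R t ^+ 2 * (f xs - f (x t.+1)) +
    L / 2 * sqdist (beta R t *: x t.+1 - (beta R t - 1) *: x t) xs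
  <= (beta R t ^+ 2 - beta R t) * (f xs - f (x t)) +
    L / 2 * sqdist (beta R t *: y t - (beta R t - 1) *: x t) xs.
Proof.
have xD : in_Delta k (x t) by case: t => // t; case: (x_step t).
have h1 := gradient_step _ _ _ (x_step t) xD.
have h2 := gradient_step _ _ _ (x_step t) xsD.
have b1 := beta_ge1 R t; set b := beta R t in b1 *.
have bb : 0 <= b * (b - 1) by rewrite mulr_ge0; lra.
have b0 : 0 <= b by lra.
have := lerD (ler_wpM2l bb h1) (ler_wpM2l b0 h2).
set X := x t; set Y := y t; set P := x t.+1.
suff -> : b * (b - 1) * (L / 2 * (sqdist X Y - sqdist X P)) +
    b * (L / 2 * (sqdist xs Y - sqdist xs P)) =
    L / 2 * (sqdist (b *: Y - (b - 1) *: X) xs) -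
    L / 2 * (sqdist (b *: P - (b - 1) *: X) xs) by nra.
rewrite /sqdist !(mulrBr, mulr_sumr) -!sumrB -big_split/=.
by apply: eq_bigr => i _; rewrite !mxE; field.
Qed.

(** At t = 0 the weight beta^2 - beta vanishes, so only the distance remains. Afterwards the
    momentum coefficient is exactly the one for which the extrapolated point before a step equals
    the one left by the previous step. *)
Lemma potential_le (t : nat) :
  beta R t ^+ 2 * (f xs - f (x t.+1)) +
    L / 2 * sqdist (beta R t *: x t.+1 - (beta R t - 1) *: x t) xs
  <= L / 2 * sqdist (x 0%N) xs.
Proof.
elim: t => [|t IH].
  have := potential_step 0; rewrite y0 /= expr1n subrr mul0r add0r.
  by rewrite !scale1r !scale0r !subr0.
apply: le_trans (potential_step t.+1) _; rewrite betaS_sqr.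
have bn0 : beta R t.+1 != 0 by rewrite gt_eqF// (lt_le_trans ltr01)// beta_ge1.
suff -> : beta R t.+1 *: y t.+1 - (beta R t.+1 - 1) *: x t.+1 =
    beta R t *: x t.+1 - (beta R t - 1) *: x t by exact: IH.
by apply/rowP => i; rewrite y_step !mxE; field.
Qed.

Lemma accelerated_gradient_rate (t : nat) : (0 < t)%N ->
  f xs - f (x t) <= 2 * L * sqdist (x 0%N) xs / t%:R ^+ 2.
Proof.
case: t => // t _.
have D0 : 0 <= sqdist (x 0%N) xs by apply: sumr_ge0 => i _; exact: sqr_ge0.
(* A nonpositive gap is trivial; a positive one may be multiplied by the lower bound on beta^2. *)
have [h|h] := leP (f xs - f (x t.+1)) 0.
  by apply: le_trans h _; rewrite divr_ge0 ?exprn_ge0// mulr_ge0// mulr_ge0// ltW.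
have := potential_le t; set u := L / 2 * sqdist _ xs.
have u0 : 0 <= u.
  by rewrite mulr_ge0 ?divr_ge0 ?(ltW L0)//; apply: sumr_ge0 => i _; exact: sqr_ge0.
(* The iterate t + 1 is governed by beta_t >= (t + 2)/2, which exceeds (t + 1)/2. *)
have hb : t.+1%:R ^+ 2 <= 4 * beta R t ^+ 2.
  rewrite (_ : 4 * _ = (2 * beta R t) ^+ 2); last by ring.
  have b0 : 0 <= beta R t := le_trans ler01 (beta_ge1 R t).
  rewrite ler_sqr ?nnegrE ?mulr_ge0// mulrC -ler_pdivrMr//.
  by apply: le_trans (beta_ge R t); rewrite ler_pM2r// ler_nat.
rewrite ler_pdivlMr ?exprn_gt0 ?ltr0n// => pot.
by have := ler_wpM2l (ltW h) hb; lra.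
Qed.

End AcceleratedGradient.

(** * Concave sequences and their piecewise linear extension *)

Section ConcaveSequence.
Variables (R : realType) (phi : nat -> R).
Hypothesis phi_adm : admissible_phi phi.

Lemma increment_le m d : phi (m + d).+1 - phi (m + d)%N <= phi m.+1 - phi m.
Proof.
case: phi_adm => _ _ _ cc.
elim: d => [|d IH]; first by rewrite addn0.
by rewrite addnS; apply: le_trans (cc _) IH.
Qed.

Lemma increment01 m : 0 <= phi m.+1 - phi m <= 1.
Proof.
case: phi_adm => p0 p1 nd _; apply/andP; split; first by rewrite subr_ge0.
by have := increment_le 0 m; rewrite add0n p0 p1 subr0.
Qed.

(** Increments decrease, so the first one bounds the chord above. The lower bound uses the increment
    just after the chord, which is the slope of the piece starting at its right end. *)
Lemma concave_chord m d :
  d%:R * (phi (m + d).+1 - phi (m + d)%N) <= phi (m + d)%N - phi m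
    <= d%:R * (phi m.+1 - phi m).
Proof.
case: phi_adm => _ _ _ cc.
elim: d => [|d /andP[lo hi]]; first by rewrite addn0 !mul0r subrr lexx.
have c1 := cc (m + d)%N; have c2 := increment_le m d.
have d0 : 0 <= d%:R :> R by [].
rewrite addnS -natr1; apply/andP; split; last by lra.
have := ler_wpM2l d0 c1; lra.
Qed.

(** A concave function lies below the line through any of its pieces; the upper chord bound serves
    pieces to the left of s, the lower one pieces to the right. *)
Lemma phi_ext_le_tangent (s : R) (m : nat) : 0 <= s ->
  phi_ext phi s <= phi m + (phi m.+1 - phi m) * (s - m%:R).
Proof.
move=> s0; rewrite /phi_ext; have /andP[fs sf] := truncn_itv s0.
set f := Num.truncn s in fs sf *.
have [mf|fm] := leqP m f.
  have := concave_chord m (f - m); have := increment_le m (f - m).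
  rewrite subnKC// natrB// => h1 /andP[_ h2].
  have h3 : 0 <= s - f%:R by lra.
  by have := ler_wpM2r h3 h1; lra.
have := concave_chord f.+1 (m - f.+1); have := increment_le f (m - f).
rewrite subnKC ?(ltnW fm)// subnKC// natrB// => h1 /andP[h2 _].
have h3 : 0 <= f.+1%:R - s by lra.
have := ler_wpM2r h3 h1; rewrite -natr1 in h2 *; lra.
Qed.

Lemma phi_ext_nat (m : nat) : phi_ext phi m%:R = phi m.
Proof. by rewrite /phi_ext natrK subrr mulr0 addr0. Qed.

Lemma phi_mono i j : (i <= j)%N -> phi i <= phi j.
Proof.
case: phi_adm => _ _ nd _ /subnKC <-.
by elim: (j - i)%N => [|d IH]; rewrite ?addn0// addnS (le_trans IH).
Qed.

(** On [0, 1] the extension is the identity, and beyond 1 it is at least phi(1) = 1. *)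
Lemma phi_ext_ge (a s : R) : 0 <= a <= 1 -> a <= s -> a <= phi_ext phi s.
Proof.
case: phi_adm => p0 p1 nd _ /andP[a0 a1] as_; have s0 := le_trans a0 as_.
rewrite /phi_ext; have /andP[fs sf] := truncn_itv s0.
case: (Num.truncn s) fs sf => [|f] fs sf.
  by rewrite p0 p1 subr0 mul1r add0r subr0.
have h : phi 1%N <= phi f.+1 by exact: phi_mono.
rewrite p1 in h; apply: le_trans a1 _; apply: le_trans h _.
by rewrite lerDl mulr_ge0// subr_ge0.
Qed.

End ConcaveSequence.

(** * Concavity, smoothness and approximation quality of the smoothed objective *)

Section SmoothedObjective.
Variables (R : realType) (n : nat) (RT : finType) (N : RT -> {set 'I_n}).
Variables (w : RT -> R) (phi : nat -> R) (mu : R).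
Hypothesis N0 : forall j, N j != finset.set0.
Hypothesis w0 : forall j, 0 <= w j.
Hypothesis phi_adm : admissible_phi phi.
Hypothesis mu0 : 0 < mu.

(** Pieces are counted from 0: index m stands for [ell] at m + 1, written as an affine function of
    the load. *)
Let slope (m : nat) := phi m.+1 - phi m.
Let offset (m : nat) := phi m - slope m * m%:R.
Let sm j := softmin R nat mu (index_iota 0 (deg N j)) offset slope.

Let f := Ctilde N w phi mu.

Lemma deg_gt0 j : (0 < deg N j)%N.
Proof. by rewrite card_gt0. Qed.

Lemma Ctilde_softmin (x : 'rV[R]_n) :
  Ctilde N w phi mu x = \sum_j w j * sm j (load N x j).
Proof.
apply: eq_bigr => j _; rewrite /sm /softmin big_add1 /=.
congr (_ * (_ * ln _)); apply: eq_bigr => i _; congr (expR (- _ / _)).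
by rewrite /ell /= /offset /slope; ring.
Qed.

Lemma loadB (x z : 'rV[R]_n) j :
  load N (x - z) j = load N x j - load N z j.
Proof. by rewrite /load -sumrB; apply: eq_bigr => i _; rewrite !mxE. Qed.

(** Cauchy-Schwarz on N(j) costs a factor deg(j), whose weighted mean is [dR]. *)
Lemma sum_load_sqr_le (v : 'rV[R]_n) :
  \sum_j w j * load N v j ^+ 2 <= dR N w * \sum_i v 0 i ^+ 2.
Proof.
rewrite /dR mulr_suml; apply: ler_sum => j _; rewrite -mulrA ler_wpM2l//.
apply: le_trans (sqr_sum_le_card _ _ _ _) _; rewrite ler_wpM2l//.
rewrite [leRHS](bigID [in N j])/= lerDl.
by apply: sumr_ge0 => i _; exact: sqr_ge0.
Qed.

(** The one-dimensional sandwiches are summed over j; the errors w_j load^2 / (8 mu) total at most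
    dR / (8 mu) times the squared distance. *)
Lemma Ctilde_sandwich (y : 'rV[R]_n) : exists G : 'rV[R]_n, forall z : 'rV[R]_n,
  Ctilde N w phi mu y + \sum_i G 0 i * (z 0 i - y 0 i)
     - dR N w / (4 * mu) / 2 * sqdist z y <= Ctilde N w phi mu z
  <= Ctilde N w phi mu y + \sum_i G 0 i * (z 0 i - y 0 i).
Proof.
have sizeN j : (0 < size (index_iota 0 (deg N j)))%N.
  by rewrite size_iota subn0 deg_gt0.
have ex j : exists s, forall d,
    sm j (load N y j) + s * d - d ^+ 2 / (8 * mu)
      <= sm j (load N y j + d) <= sm j (load N y j) + s * d.
  by apply: softmin_sandwich => // m; exact: increment01.
have [g gP] := choice ex.
(* Chain rule: coordinate i collects the slopes of all j adjacent to i. *)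
exists (\row_i \sum_(j | i \in N j) w j * g j) => z.
have lin : \sum_i (\row_i \sum_(j | i \in N j) w j * g j : 'rV[R]_n) 0 i * (z 0 i - y 0 i)
    = \sum_j w j * (g j * load N (z - y) j).
  under eq_bigr do rewrite mxE mulr_suml.
  rewrite (exchange_big_dep xpredT)//=; apply: eq_bigr => j _.
  by rewrite /load !mulr_sumr; apply: eq_bigr => i _; rewrite !mxE mulrA.
rewrite lin !Ctilde_softmin.
have lz j : load N z j = load N y j + load N (z - y) j.
  by rewrite loadB addrC subrK.
apply/andP; split.
  have := sum_load_sqr_le (z - y).
  have -> : \sum_i (z - y) 0 i ^+ 2 = sqdist z y.
    by apply: eq_bigr => i _; rewrite !mxE.
  have k0 : 0 <= (8 * mu)^-1 by rewrite invr_ge0 mulr_ge0// ltW.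
  move/(ler_wpM2l k0) => h.
  apply: (@le_trans _ _ (\sum_j w j * sm j (load N y j) +
     \sum_j w j * (g j * load N (z - y) j) -
     (8 * mu)^-1 * \sum_j w j * load N (z - y) j ^+ 2)).
    rewrite lerD2l lerN2; apply: le_trans h _.
    rewrite le_eqVlt; apply/orP; left; apply/eqP; field.
    by rewrite gt_eqF.
  rewrite mulr_sumr -big_split -sumrB/=; apply: ler_sum => j _.
  have /andP[h1 _] := gP j (load N (z - y) j).
  by rewrite lz; have := ler_wpM2l (w0 j) h1; lra.
rewrite -big_split/=; apply: ler_sum => j _; rewrite -mulrDr lz ler_wpM2l//.
by have /andP[] := gP j (load N (z - y) j).
Qed.

(** Along each coordinate direction the sandwich is a first-order expansion with quadratic
    remainder, which forces its linear coefficients to be the partial derivatives. *)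
Lemma Ctilde_grad_sandwich (y z : 'rV[R]_n) :
  f y + \sum_i grad f y 0 i * (z 0 i - y 0 i)
     - dR N w / (4 * mu) / 2 * sqdist z y <= f z
  <= f y + \sum_i grad f y 0 i * (z 0 i - y 0 i).
Proof.
have [G GP] := Ctilde_sandwich y; rewrite -/f in GP.
suff -> : grad f y = G by exact: GP.
apply/rowP => u; rewrite mxE.
pose K := dR N w / (4 * mu) / 2.
apply: (@derive_of_quadratic_remainder _ _ _ _ _ _ K) => h.
have := GP (y + h *: delta_mx 0 u); rewrite -/f.
have -> : \sum_i G 0 i * ((y + h *: delta_mx 0 u) 0 i - y 0 i) = h * G 0 u.
  rewrite (bigD1 u)//= big1 => [|i iu]; rewrite !mxE !eqxx ?(negbTE iu)/=; ring.
have -> : sqdist (y + h *: delta_mx 0 u) y = h ^+ 2.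
  rewrite /sqdist (bigD1 u)//= big1 => [|i iu]; rewrite !mxE !eqxx ?(negbTE iu)/=; ring.
have K0 : 0 <= K * h ^+ 2.
  rewrite mulr_ge0 ?sqr_ge0// !divr_ge0 ?mulr_ge0 ?(ltW mu0)//.
  by apply: sumr_ge0 => j _; rewrite mulr_ge0.
by rewrite -/K ler_norml => /andP[h1 h2]; apply/andP; split; lra.
Qed.

Lemma Cobj_le_Ctilde (x : 'rV[R]_n) : \sum_j w j = 1 -> 0 < dR N w ->
  (forall i, 0 <= x 0 i) ->
  Cobj N w phi x - mu * ln (dR N w) <= Ctilde N w phi mu x.
Proof.
move=> w1 d0 x0; rewrite Ctilde_softmin.
set d := dR N w in d0 *.
(* Tangent to ln at [d]: the correction deg(j)/d - 1 has weighted mean 0, so this is Jensen's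
   inequality for ln. *)
have lnd j : ln (deg N j)%:R <= ln d + ((deg N j)%:R / d - 1).
  have dj : 0 < (deg N j)%:R :> R by rewrite ltr0n deg_gt0.
  rewrite -lerBlDl -ln_div ?posrE//.
  have /le_ln1Dx : -1 < (deg N j)%:R / d - 1 by rewrite ltrBDr addNr divr_gt0.
  by rewrite addrC subrK.
apply: (@le_trans _ _ (\sum_j w j * (phi_ext phi (load N x j) -
    mu * (ln d + ((deg N j)%:R / d - 1))))).
  rewrite le_eqVlt; apply/orP; left; apply/eqP; rewrite /Cobj.
  transitivity (\sum_j w j * phi_ext phi (load N x j) -
     (mu * (ln d - 1) * \sum_j w j + mu / d * \sum_j w j * (deg N j)%:R)).
    by rewrite w1 -/(dR N w) -/d; field; rewrite gt_eqF.
  rewrite !mulr_sumr -big_split -sumrB/=; apply: eq_bigr => j _; ring.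
apply: ler_sum => j _; rewrite ler_wpM2l//.
apply: (@le_trans _ _ (phi_ext phi (load N x j) - mu * ln (deg N j)%:R)).
  by rewrite lerD2l lerN2 ler_pM2l.
have l0 : 0 <= load N x j by apply: sumr_ge0.
have := @softmin_ge R nat mu (index_iota 0 (deg N j)) offset slope mu0.
rewrite size_iota subn0; apply; first exact: deg_gt0.
move=> m; apply: le_trans (phi_ext_le_tangent _ _ phi_adm _ m l0) _.
by rewrite /offset /slope le_eqVlt; apply/orP; left; apply/eqP; ring.
Qed.

End SmoothedObjective.

(** * Diameter of the feasible set and a lower bound on the objective *)

Lemma sqdist_in_Delta (R : realType) (n k : nat) (a b : 'rV[R]_n) :
  in_Delta k a -> in_Delta k b -> sqdist a b <= 2 * k%:R.
Proof.
move=> [a01 ak] [b01 bk].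
rewrite mulr_natl mulr2n -{1}ak -bk -big_split/=; apply: ler_sum => i _.
(* For a, b in [0, 1], (a - b)^2 <= a + b. *)
by case/andP: (a01 i) => a0 a1; case/andP: (b01 i) => b0 b1; nra.
Qed.

Lemma Cobj_ge (R : realType) (n : nat) (RT : finType) (N : RT -> {set 'I_n})
    (w : RT -> R) (phi : nat -> R) (a : R) (x : 'rV[R]_n) :
  (forall j, N j != finset.set0) -> (forall j, 0 <= w j) -> \sum_j w j = 1 ->
  admissible_phi phi -> 0 <= a <= 1 -> (forall i, a <= x 0 i) ->
  a <= Cobj N w phi x.
Proof.
move=> N0 w0 w1 phi_adm a01 ax.
rewrite -[leLHS]mul1r -w1 mulr_suml; apply: ler_sum => j _; rewrite ler_wpM2l//.
apply: phi_ext_ge => //; have /set0Pn[u uN] := N0 j.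
have a0 : 0 <= a by case/andP: a01.
rewrite /load (bigD1 u)//= -[leLHS]addr0 lerD//.
by apply: sumr_ge0 => i _; exact: le_trans (ax i).
Qed.

(** * The greedy set: feasibility and value *)

Section Greedy.
Variables (R : realType) (n : nat) (RT : finType) (N : RT -> {set 'I_n}).
Variables (w : RT -> R) (phi : nat -> R) (k : nat) (S : nat -> {set 'I_n}).
Hypothesis w0 : forall j, 0 <= w j.
Hypothesis phi_adm : admissible_phi phi.
Hypothesis S_greedy : greedy_seq N w phi k S.

Lemma Cset_mono (A B : {set 'I_n}) : A \subset B -> Cset N w phi A <= Cset N w phi B.
Proof.
move=> AB; apply: ler_sum => j _; rewrite ler_wpM2l//; apply: (phi_mono _ _ phi_adm).
by apply: subset_leq_card; exact: finset.setSI.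
Qed.

Lemma Cobj_indicvec (A : {set 'I_n}) : Cobj N w phi (indicvec R A) = Cset N w phi A.
Proof.
apply: eq_bigr => j _; rewrite (_ : load _ _ _ = #|A :&: N j|%:R) ?phi_ext_nat//.
rewrite -sum1_card natr_sum /load /indicvec big_mkcond [RHS]big_mkcond/=.
by apply: eq_bigr => u _; rewrite mxE inE; case: (u \in A); case: (u \in N j).
Qed.

Lemma greedy_card t : (t <= k)%N -> #|S t| = t.
Proof.
case: S_greedy => S0 Sn; elim: t => [|t IH] tk; first by rewrite S0 cards0.
have [i [iS -> _]] := Sn _ tk.
by rewrite cardsU1 iS IH// ltnW.
Qed.

Lemma indicvec_greedy_in_Delta : in_Delta k (indicvec R (S k)).
Proof.
rewrite /indicvec; split=> [i|]; first by rewrite mxE; case: (i \in _) => /=; rewrite ?lexx ?ler01.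
rewrite -[in RHS](greedy_card k)// -sum1_card natr_sum [RHS]big_mkcond/=.
by apply: eq_bigr => i _; rewrite mxE; case: (i \in _).
Qed.

Lemma greedy_mono t u : (t <= u <= k)%N -> S t \subset S u.
Proof.
case: S_greedy => _ Sn /andP[/subnKC <-]; move: (u - t)%N => d.
elim: d => [|d IH]; first by rewrite addn0.
rewrite addnS => dk; apply: fintype.subset_trans (IH (ltnW dk)) _.
by have [i [_ -> _]] := Sn _ dk; exact: subsetU1.
Qed.

Lemma Cset1 i : Cset N w phi [set i] = \sum_(j | i \in N j) w j.
Proof.
case: phi_adm => p0 p1 _ _.
rewrite [RHS]big_mkcond/=; apply: eq_bigr => j _.
case: ifPn => iN.
  have /finset.setIidPl -> : [set i] \subset N j by rewrite finset.sub1set.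
  by rewrite cards1 p1 mulr1.
rewrite (_ : _ :&: _ = finset.set0) ?cards0 ?p0 ?mulr0//.
by apply/eqP; rewrite finset.setI_eq0 disjoints1.
Qed.

(* The first greedy pick is at least the average over all i of C({i}). *)
Lemma dR_le_greedy : (0 < k)%N -> dR N w <= n%:R * Cset N w phi (S k).
Proof.
move=> k0; case: S_greedy => S0 Sn; have [i [_ S1 imax]] := Sn 0%N k0.
rewrite S0 finset.setU0 in S1 imax.
(* Both sides count the edges by weight, since a singleton covers each neighbour with value phi(1) =
   1. *)
have -> : dR N w = \sum_i Cset N w phi [set i].
  under [RHS]eq_bigr do rewrite Cset1.
  rewrite (exchange_big_dep xpredT)//=; apply: eq_bigr => j _.
  by rewrite sumr_const mulr_natr.
rewrite -[n in n%:R]card_ord mulr_natl -sumr_const; apply: ler_sum => i' _.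
apply: (@le_trans _ _ (Cset N w phi (S 1%N))).
  by have := imax i'; rewrite inE finset.setU0 S1 lerD2r; apply.
by apply: Cset_mono; apply: greedy_mono; rewrite k0 leqnn.
Qed.

End Greedy.

(** * Combination of smoothing error and optimization error *)

Theorem mainTheorem8 (R : realType) (n : nat) (RT : finType)
  (N : RT -> {set 'I_n}) (w : RT -> R) (k : nat) (phi : nat -> R)
  (S : nat -> {set 'I_n}) (xstar : 'rV[R]_n)
  (x y : nat -> 'rV[R]_n) (eps : R) :
  (forall j, N j != finset.set0) ->
  (forall j, 0 <= w j) -> \sum_j w j = 1 ->
  (1 <= k <= n)%N ->
  admissible_phi phi ->
  1 < dR N w ->
  in_Delta k xstar ->
  (forall z, in_Delta k z -> Cobj N w phi z <= Cobj N w phi xstar) ->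
  greedy_seq N w phi k S ->
  0 < eps ->
  let xg := indicvec R (S k) in
  let mu := eps * Cobj N w phi xg / (2 * ln (dR N w)) in
  let eta := 4 * mu / dR N w in
  x 0%N = xg -> y 0%N = xg ->
  (forall t, is_proj_Delta k (y t + eta *: grad (Ctilde N w phi mu) (y t)) (x t.+1)) ->
  (forall t, y t.+1 = x t.+1 + ((beta R t - 1) / beta R t.+1) *: (x t.+1 - x t)) ->
  forall t : nat, 51 / 10 / eps * n%:R * Num.sqrt (ln n%:R) <= t%:R ->
    (1 - eps) * Cobj N w phi xstar <= Ctilde N w phi mu (x t).
Proof.
move=> N0 w0 w1 /andP[k0 kn] phi_adm d1 xsD xs_max S_greedy eps0 xg.
set d := dR N w in d1 *; set Cg := Cobj N w phi xg; set Cs := Cobj N w phi xstar in xs_max *.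
move=> mu eta x0 y0 x_step y_step t t_ge.
have xgD : in_Delta k xg := indicvec_greedy_in_Delta _ _ _ _ _ _ _ _ S_greedy.
have n0 : (0 < n)%N := leq_trans k0 kn.
have nR0 : 0 < n%:R :> R by rewrite ltr0n.
have kR0 : 0 < k%:R :> R by rewrite ltr0n.
have kn01 : 0 <= (k%:R / n%:R : R) <= 1.
  by rewrite ler_pdivrMr// mul1r ler_nat kn divr_ge0.
have d0 : 0 < d := lt_trans ltr01 d1.
have lnd0 : 0 < ln d := ln_gt0 d1.
have Cg_ge : d <= n%:R * Cg.
  by rewrite /Cg Cobj_indicvec; exact: dR_le_greedy phi_adm S_greedy k0.
have Cg0 : 0 < Cg by rewrite -(pmulr_rgt0 _ nR0) (lt_le_trans d0).
have CgCs : Cg <= Cs by exact: xs_max.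
have Cs_ge : k%:R <= n%:R * Cs.
  have uD : in_Delta k (const_mx (k%:R / n%:R) : 'rV[R]_n).
    split=> [i|]; first by rewrite mxE.
    under eq_bigr do rewrite mxE.
    by rewrite sumr_const card_ord -[LHS]mulr_natr divfK// gt_eqF.
  rewrite mulrC -ler_pdivrMr//; apply: le_trans (xs_max _ uD).
  by apply: Cobj_ge => // i; rewrite mxE.
have mu0 : 0 < mu by rewrite divr_gt0 ?mulr_gt0.
have L0 : 0 < d / (4 * mu) by rewrite divr_gt0// (mulr_gt0 _ mu0).
have etaE : eta = (d / (4 * mu))^-1 by rewrite invf_div.
rewrite etaE in x_step.
have sand := Ctilde_grad_sandwich _ _ _ _ _ _ _ N0 w0 phi_adm mu0.
have f_le u z := (andP (sand u z)).2; have f_ge u z := (andP (sand u z)).1.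
(* Degrees are at most n; hence ln d <= ln n, and d > 1 makes ln n positive. *)
have dn : d <= n%:R.
  have -> : n%:R = (\sum_j w j) * n%:R :> R by rewrite w1 mul1r.
  rewrite /d /dR mulr_suml; apply: ler_sum => j _.
  by rewrite ler_wpM2l// ler_nat -[leqRHS]card_ord max_card.
have lndn : ln d <= ln n%:R by rewrite ler_ln ?posrE.
have lnn0 : 0 < ln n%:R :> R := lt_le_trans lnd0 lndn.
(* The constant 26 comes from 5.1^2 = 26.01. *)
have t_ge2 : 26 * n%:R ^+ 2 * ln n%:R <= eps ^+ 2 * t%:R ^+ 2.
  have ts : 0 <= 51 / 10 / eps * n%:R * Num.sqrt (ln n%:R).
    by rewrite !mulr_ge0 ?sqrtr_ge0// invr_ge0 ltW.
  have := t_ge; rewrite -ler_sqr ?nnegrE// => t_sq.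
  have e2 : 0 <= eps ^+ 2 by rewrite sqr_ge0.
  have := ler_wpM2l e2 t_sq; apply: le_trans.
  rewrite (_ : eps ^+ 2 * _ = 51 ^+ 2 / 100 * n%:R ^+ 2 * Num.sqrt (ln n%:R) ^+ 2); last first.
    by field; rewrite gt_eqF.
  rewrite sqr_sqrtr ?(ltW lnn0)// ler_pM2r// ler_pM2r ?exprn_gt0//; lra.
have T0 : (0 < t)%N.
  rewrite -(ltr0n R); apply: lt_le_trans t_ge.
  by rewrite !mulr_gt0 ?invr_gt0 ?sqrtr_gt0.
have TR0 : 0 < t%:R ^+ 2 :> R by rewrite exprn_gt0// ltr0n.
have x0D : in_Delta k (x 0%N) by rewrite x0.
have yx0 : y 0%N = x 0%N by rewrite y0.
have := @accelerated_gradient_rate R n k (Ctilde N w phi mu)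
  (grad (Ctilde N w phi mu)) _ L0 f_le f_ge x y xstar xsD x0D yx0 x_step y_step t T0.
have := sqdist_in_Delta _ _ _ _ _ x0D xsD.
set D := sqdist _ _ => D_le rate.
have smooth : Cs - mu * ln d <= Ctilde N w phi mu xstar.
  by apply: Cobj_le_Ctilde => // i; case: xsD => /(_ i)/andP[].
have mulnd : mu * ln d = eps * Cg / 2 by rewrite /mu; field; rewrite gt_eqF.
have gap : 2 * (d / (4 * mu)) * D / t%:R ^+ 2 <= eps * Cs / 2.
  have Cs0 : 0 < Cs := lt_le_trans Cg0 CgCs.
  (* The product of the lower bounds k / n on [Cs] and d / n on [Cg]. *)
  have kd : k%:R * d <= n%:R ^+ 2 * (Cg * Cs).
    rewrite (_ : _ * (Cg * Cs) = (n%:R * Cs) * (n%:R * Cg)); last by ring.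
    by rewrite ler_pM// ltW.
  have key : 4 * (k%:R * d) * ln d <= eps ^+ 2 * t%:R ^+ 2 * (Cg * Cs).
    apply: (@le_trans _ _ (26 * n%:R ^+ 2 * ln n%:R * (Cg * Cs))); last first.
      by rewrite ler_pM2r ?mulr_gt0.
    have kd0 : 0 <= k%:R * d by rewrite mulr_ge0 ?ltW.
    have h1 := ler_wpM2l kd0 lndn.
    have h2 := ler_wpM2r (ltW lnn0) kd.
    have h3 : 0 <= k%:R * d * ln d by rewrite mulr_ge0 ?(ltW lnd0).
    lra.
  rewrite ler_pdivrMr//.
  apply: (@le_trans _ _ (2 * (d / (4 * mu)) * (2 * k%:R))).
    by rewrite ler_wpM2l// mulr_ge0 ?ltW.
  have eCg0 : 0 < eps * Cg by rewrite mulr_gt0.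
  (* Multiplying by eps Cg = 2 mu ln d clears mu from the smoothness constant and leaves [key]
     halved. *)
  rewrite -(ler_pM2l eCg0).
  rewrite (_ : _ * (2 * _ * _) = (4 * (k%:R * d) * ln d) / 2); last first.
    by rewrite /mu; field; rewrite !gt_eqF.
  rewrite (_ : _ * (_ / 2 * _) = (eps ^+ 2 * t%:R ^+ 2 * (Cg * Cs)) / 2); last by ring.
  by rewrite ler_pM2r.
(* The smoothing error eps Cg / 2 is now also at most eps Cs / 2, and the two halves add up to eps
   Cs. *)
have : eps * Cg <= eps * Cs by rewrite ler_pM2l.
lra.
Qed.
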